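(* Let $k\ge i\ge 1$ be integers. For every $n\ge 0$, let $D_{k,i}(n)$ denote the number of overpartitions of $n$ of the form $d_1+d_2+\cdots+d_s$ such that $1$ occurs as a non-overlined part at most $i-1$ times, and such that for every $j$ with $1\le j\le s-k+1$ one has $d_j-d_{j+k-1}\ge 1$ if $d_j$ is overlined and $d_j-d_{j+k-1}\ge 2$ otherwise. If $k>i\ge 1$, let $C_{k,i}(n)$ denote the number of overpartitions of $n$ whose non-overlined parts are not congruent to $0,\pm i$ modulo $2k$; and let $C_{k,k}(n)$ denote the number of overpartitions of $n$ with (overlined and non-overlined) parts not divisible by $k$. Then $C_{k,i}(n)=D_{k,i}(n)$ for all $n\ge 0$.
   Context: An overpartition of $n$ is a partition of $n$ in which the first occurrence of each part size may be overlined. Its parts $d_1,d_2,\ldots,d_s$ are written in non-increasing order of numerical value, and, since it is the first occurrence that may be overlined, an overlined part $\overline{t}$ is listed before all non-overlined copies of $t$ (e.g. $(\overline 7,7,6,\overline 5,2,\overline 1)$ is an overpartition of $28$). Differences $d_j-d_{j+k-1}$ are differences of the underlying numerical values. The empty overpartition is the unique overpartition of $0$. *)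

(* Defs.v *)
From HB Require Import structures.
From mathcomp Require Import all_boot.

Set Implicit Arguments.
Unset Strict Implicit.
Unset Printing Implicit Defensive.

(* A part is a pair (value, flag); the flag is true iff the part is overlined. *)
Notation part := (nat * bool)%type.

Definition value (d : part) : nat := d.1.
Definition overlined (d : part) : bool := d.2.

(* Values are non-increasing, and an overlined part has a value strictly      *)
(* smaller than the part listed just before it, i.e., is the first occurrence *)
(* of its value.                                                              *)
Definition may_follow (d e : part) : bool :=
  (value e <= value d) && (overlined e ==> (value e < value d)).

Definition is_overpartition (n : nat) (s : seq part) : bool :=
  [&& sorted may_follow s, all (fun d => 0 < value d) s
    & sumn (map value s) == n].

Record overpartition (n : nat) : Type := Overpartition {
  parts :> seq part;
  partsP : is_overpartition n parts
}.

HB.instance Definition _ n := [isSub for @parts n].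
HB.instance Definition _ n := [Countable of overpartition n by <:].

(* An overpartition of n has at most n parts, all of value at most n, so that *)
(* overpartition n embeds into a finite type.                                 *)
Definition bounded_of n (s : overpartition n) : n.-bseq ('I_n.+1 * bool) :=
  insub_bseq n [seq (inord (value d), overlined d) | d <- parts s].

Definition of_bounded n (b : n.-bseq ('I_n.+1 * bool)) :
    option (overpartition n) :=
  insub [seq (nat_of_ord d.1, d.2) | d <- b].

Lemma bounded_ofK n : pcancel (@bounded_of n) (@of_bounded n).
Proof.
case=> s sP; rewrite /of_bounded /bounded_of /insub_bseq /insubd /=.
have /and3P[_ s_gt0 /eqP sum_s] := sP.
have le_size : size s <= n.
  rewrite -[n]sum_s; elim: (s) s_gt0 => //= d t IHt /andP[d_gt0 /IHt].
  by rewrite -[(size t).+1]add1n; apply: leq_add.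
have le_val d : d \in s -> value d <= n.
  rewrite -[n]sum_s; elim: (s) => //= e t IHt.
  rewrite inE => /predU1P[-> | /IHt le_d]; first exact: leq_addr.
  exact: leq_trans le_d (leq_addl _ _).
rewrite (insubT (fun t => size t <= n)) ?size_map //= => le_size'.
rewrite -map_comp map_id_in => [|d /le_val le_d]; last first.
  by rewrite /= inordK // -surjective_pairing.
by rewrite insubT; congr Some; apply: val_inj.
Qed.

HB.instance Definition _ n := isFinite.Build (overpartition n)
  (pcan_enumP (@bounded_ofK n)).

(* The difference condition d_j - d_{j+k-1} >= 1 or 2; the index j : 'I_(size *)
(* s) is counted from 0, so that 1 <= j <= s - k + 1 becomes j + k <= size s. *)
(* Truncated subtraction is harmless as the lower bounds are positive.        *)
Definition difference_condition (k : nat) (s : seq part) : bool :=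
  [forall j : 'I_(size s), (j + k <= size s) ==>
    let dj := nth (0, false) s j in
    let dl := nth (0, false) s (j + k - 1) in
    (if overlined dj then 1 else 2) <= value dj - value dl].

Definition D (k i n : nat) : nat :=
  #|[set s : overpartition n |
      (count_mem (1, false) (parts s) <= i - 1)
      && difference_condition k (parts s)]|.

(* v is congruent to - i modulo m iff v + i is congruent to 0. *)
Definition avoids_residues (k i v : nat) : bool :=
  [&& v != 0 %[mod 2 * k], v != i %[mod 2 * k] & v + i != 0 %[mod 2 * k]].

(* Only meaningful for 1 <= i <= k: the first case is i < k, the second i = k. *)
Definition C (k i n : nat) : nat :=
  if i < k then
    #|[set s : overpartition n |
        all (fun d => ~~ overlined d ==> avoids_residues k i (value d))
          (parts s)]|
  else
    #|[set s : overpartition n |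
        all (fun d => ~~ (k %| value d)) (parts s)]|.

(* Main.v *)
Require Import Defs.
From mathcomp Require Import all_boot all_algebra.
From mathcomp Require Import zify ring.

(* Let D_i(a) be the generating function of the overpartitions counted by     *)
(* D_{k,i}, but with all parts larger than a and a+1 in the role of 1.        *)
(* Removing the parts equal to a+1 gives                                      *)
(*   D_{i+1}(a) - D_i(a) =                                                    *)
(*     q^((a+1)i) D_{k-i}(a+1) + q^((a+1)(i+1)) D_{k-i-1}(a+1),               *)
(* together with D_0(a) = 0, and D_i(a) = 1 modulo q^(a+1) for i > 0; this    *)
(* determines all D_i(a). The same relations hold for the series              *)
(*   sum_n (-1)^n q^(akn + kn^2 + (k-i)n) (1 - q^(i(a+2n+1)))                 *)
(*     (-q;q)_n / (q;q)_n * (-q^(n+a+1);q)_oo / (q^(n+a+1);q)_oo,             *)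
(* which at a = 0 is, by Jacobi's triple product identity, the infinite       *)
(* product that generates the overpartitions counted by C_{k,i}.              *)
(*   Coefficients of q^n only matter for n <= N, so everything takes place in *)
(* a ring where q^(N+1) = 0: sums and products are finite, and clearing the   *)
(* denominators by (q;q)_N loses nothing as 1 - q^j is not a zero divisor.    *)

Set Implicit Arguments.
Unset Strict Implicit.
Unset Printing Implicit Defensive.

Import GRing.Theory.

(** * Series modulo q^(N+1) *)

(** Sum side: the parts of the smallest possible value v = a+1 end the list, and
    [difference_condition_block] shows that their removal affects the rest only through a bound on
    the non-overlined copies of v+1. That is again a condition of the original kind, with a new i,
    so the generating functions [gordon_gf] satisfy the recurrence [gordon_gf_sum]. Analytic side:
    the alternating series [gordon] satisfies the same recurrence by [gordonS]. Both vanish at i = 0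
    and agree at a = N up to the factor (q;q)_N, hence [gordon_gfE]. Product side: at a = 0 the
    series is evaluated by [triple_product]; [gordon_avoids] and [gordon_ndvd] read the result as
    the product for [C], which [gf_all] matches with overpartitions. Finally [card_gf] extracts the
    coefficient of q^n over the integers. *)

Section Truncated.

Local Open Scope ring_scope.

Variables (R : comNzRingType) (q : R) (N : nat).
Hypothesis q_nilp : q ^+ N.+1 = 0.

Lemma expq_eq0 e : (N < e)%N -> q ^+ e = 0.
Proof. by move=> lt_Ne; rewrite -(subnKC lt_Ne) exprD q_nilp mul0r. Qed.

(** If (1 - q^e) z = 0 then z = q^e z = q^(em) z for all m, which is 0 for large m by nilpotence. *)
Lemma onemq_reg e x y :
  (0 < e)%N -> (1 - q ^+ e) * x = (1 - q ^+ e) * y -> x = y.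
Proof.
move=> e_gt0 exy; apply/eqP; rewrite -subr_eq0; apply/eqP.
set z := x - y; have ez : z = q ^+ e * z.
  by apply/eqP; rewrite -subr_eq0 -{1}[z]mul1r -mulrBl /z mulrBr exy subrr.
have ezm m : z = q ^+ (e * m) * z.
  by elim: m => [|m IHm]; rewrite ?muln0 ?mul1r // mulnS exprD -mulrA -IHm.
by rewrite (ezm N.+1) expq_eq0 ?mul0r // leq_pmull.
Qed.

Lemma prod_onemq_reg (r : seq nat) x y : all (leq 1) r ->
  \prod_(j <- r) (1 - q ^+ j) * x = \prod_(j <- r) (1 - q ^+ j) * y -> x = y.
Proof.
elim: r => [|j r IHr] /=; first by rewrite big_nil !mul1r.
by case/andP=> j_gt0 /IHr{}IHr; rewrite big_cons -!mulrA => /(onemq_reg j_gt0).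
Qed.

Lemma shift_sum m (u : nat -> R) : u 0%N = 0 -> u m = 0 ->
  \sum_(n < m) u n = \sum_(n < m) u n.+1.
Proof.
move=> u0 um; apply: (addrI (u 0%N)); rewrite -(big_ord_recl m (fun j => u j)).
by rewrite big_ord_recr /= u0 um add0r addr0.
Qed.

Definition mixed_prod (s : pred nat) : R :=
  \prod_(1 <= j < N.+1) (if s j then 1 - q ^+ j else 1 + q ^+ j).

(** Only the factor at [j0] differs. For j0 > N it is absent from both products, but then q^j0 = 0
    and both multipliers are 1. *)
Lemma mixed_prod_swap (s s' : pred nat) j0 :
    (0 < j0)%N -> ~~ s j0 -> s' j0 -> (forall j, j != j0 -> s j = s' j) ->
  (1 - q ^+ j0) * mixed_prod s = (1 + q ^+ j0) * mixed_prod s'.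
Proof.
move=> j0_gt0 sj0 s'j0 eq_s; rewrite /mixed_prod.
have [le_j0N | lt_Nj0] := leqP j0 N.
  rewrite !(bigD1_seq j0) /= ?mem_index_iota ?j0_gt0 ?iota_uniq //.
  rewrite s'j0 (negPf sj0) mulrCA; congr (_ * (_ * _)).
  by apply: eq_bigr => j /eq_s ->.
rewrite expq_eq0 // subr0 addr0; congr (_ * _).
apply: eq_big_nat => j /andP[_ lt_jN]; rewrite eq_s //.
by rewrite neq_ltn (leq_trans lt_jN).
Qed.

(** * The alternating series and its recurrence *)

Section Gordon.

Variable k : nat.

(** After multiplication by (q;q)_N, the quotient of products in the n-th term has no denominator:
    just the factors 1 - q^j with n < j <= n+a survive, next to 1 + q^j for all other j. *)
Let P n a := mixed_prod (fun j => n < j <= n + a)%N.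

Let P_left n a : (1 - q ^+ n.+1) * P n.+1 a = (1 + q ^+ n.+1) * P n a.+1.
Proof. by apply: mixed_prod_swap => [|||j neq_jn]; lia. Qed.

Let P_right n a :
  (1 - q ^+ (n + a).+1) * P n a = (1 + q ^+ (n + a).+1) * P n a.+1.
Proof. by apply: mixed_prod_swap => [|||j neq_jn]; lia. Qed.

Let T i a n : R :=
  (-1) ^+ n * (q ^+ (a * k * n + k * n ^ 2 + (k - i) * n)
    * (1 - q ^+ (i * (a + n.*2.+1)))).

(* (q;q)_N times the series displayed at the top of the file. *)
Definition gordon i a := \sum_(n < N.+1) T i a n * P n a.

Let TE i a n e f : (a * k * n + k * n ^ 2 + (k - i) * n = e)%N ->
  (e + i * (a + n.*2.+1) = f)%N -> T i a n = (-1) ^+ n * (q ^+ e - q ^+ f).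
Proof. by move=> <- <-; rewrite /T mulrBr mulr1 -exprD. Qed.

Lemma gordon0 a : gordon 0 a = 0.
Proof. by apply: big1 => n _; rewrite /T mul0n subrr !mulr0 mul0r. Qed.

(** The difference of the n-th terms is [u n + v n], with factors 1 - q^n and 1 - q^(n+a+1).
    Shifting n in [u] and applying [P_left] and [P_right] makes everything a multiple of [P n a.+1];
    the four resulting powers of q regroup into the terms for k-i and k-i-1. *)
Lemma gordonS i a : (i < k)%N ->
  gordon i.+1 a = gordon i a + q ^+ (a.+1 * i) * gordon (k - i) a.+1
    + q ^+ (a.+1 * i.+1) * gordon (k - i.+1) a.+1.
Proof.
move=> lt_ik.
(* Writing k = i + h + 1 removes truncated subtraction from the exponents. *)
have [h def_k] : exists h, k = (i + h).+1 by exists (k - i.+1)%N; lia.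
pose e n := (a * k * n + k * n ^ 2 + h * n)%N.
pose u n := (-1) ^+ n * q ^+ e n * ((1 - q ^+ n) * P n a).
pose v n := (-1) ^+ n * q ^+ (e n + n + i * (a + n.*2.+1))
  * ((1 - q ^+ (n + a).+1) * P n a).
have Tuv n : T i.+1 a n * P n a = T i a n * P n a + (u n + v n).
  pose f := (e n + n + i * (a + n.*2.+1))%N.
  rewrite (@TE i.+1 a n (e n) (f + (n + a).+1)%N); last 2 first.
  - by rewrite /e def_k; lia.
  - by rewrite /f /e; nia.
  rewrite (@TE i a n (e n + n)%N f) /u /v -/f; last 2 first.
  - by rewrite /e def_k; nia.
  - by [].
  rewrite !exprD; ring.
rewrite /gordon; under eq_bigr do rewrite Tuv.
rewrite big_split /= big_split /=.
rewrite (@shift_sum _ u); last 2 first.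
- by rewrite /u subrr mul0r mulr0.
- by rewrite /u (@expq_eq0 (e _)) ?mulr0 ?mul0r // /e def_k; nia.
rewrite -[RHS]addrA; congr (_ + _).
rewrite -big_split 2!mulr_sumr -big_split /=.
apply: eq_bigr => n _; rewrite /u /v P_left P_right.
pose f := (a.+1 * k * n + k * n ^ 2 + i * n)%N.
rewrite (@TE (k - i) a.+1 n f (f + h.+1 * (a.+1 + n.*2.+1))%N); last 2 first.
- by rewrite /f def_k; nia.
- by rewrite def_k; nia.
rewrite (@TE (k - i.+1) a.+1 n (f + n) (f + n + h * (a.+1 + n.*2.+1))%N);
  last 2 first.
- by rewrite /f def_k; nia.
- by rewrite def_k; nia.
set x := q ^+ (a.+1 * i); set y := q ^+ (a.+1 * i.+1).
have fuse b m c : (b + c = m)%N -> q ^+ b * q ^+ c = q ^+ m.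
  by move=> <-; rewrite exprD.
set p := P n a.+1; set c1 := (f + h.+1 * _)%N; set c2 := (f + n + h * _)%N.
transitivity ((-1) ^+ n * p * (x * q ^+ f - x * q ^+ c1
    + (y * q ^+ (f + n) - y * q ^+ c2))); last by ring.
rewrite (fuse _ (e n + n + i * (a + n.*2.+1))%N); last first.
  by rewrite /e /f def_k; nia.
rewrite (fuse _ (e n.+1 + n.+1)%N); last by rewrite /c1 /e /f def_k; lia.
rewrite (fuse _ (e n + n + i * (a + n.*2.+1) + (n + a).+1)%N); last first.
  by rewrite /e /f def_k; nia.
rewrite (fuse _ (e n.+1)); last by rewrite /c2 /e /f def_k; lia.
rewrite exprS !(exprD q _ _.+1); ring.
Qed.

Lemma gordon_last i : (0 < i <= k)%N ->
  gordon i N = \prod_(1 <= j < N.+1) (1 - q ^+ j).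
Proof.
move=> i_bounds; rewrite /gordon big_ord_recl big1 ?addr0 => [|n _]; last first.
  by rewrite /T expq_eq0 ?mul0r ?mulr0 ?mul0r //= /bump; nia.
rewrite /T !muln0 expr0 !mul1r (@expq_eq0 (_ * _)%N) ?subr0 ?mul1r; last by nia.
by apply: eq_big_nat => j ->.
Qed.

Lemma gordon_first i : gordon i 0 = \prod_(1 <= j < N.+1) (1 + q ^+ j) *
  \sum_(n < N.+1) (-1) ^+ n *
    (q ^+ (k * n ^ 2 + (k - i) * n) * (1 - q ^+ (i * n.*2.+1))).
Proof.
rewrite mulr_sumr; apply: eq_bigr => n _; rewrite mulrC; congr (_ * _).
apply: eq_big_nat => j _; case: ifP => //; lia.
Qed.

(** * A truncated Jacobi triple product *)

Section TripleProduct.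

Variable i : nat.
Hypothesis i_bounds : (0 < i <= k)%N.

(** [theta M] is centred at l = M. The terms that can survive lie in N <= l < L, that is, from M-N-1
    to M+N, and there [tail l] is 1. *)
Let M := N.*2.+1.
Let L := (M + N.+1)%N.
(** This is (Q;Q)_oo / (Q;Q)_l modulo q^(N+1), where Q = q^(2k). *)
Let tail l := \prod_(l <= j < M) (1 - q ^+ (2 * k * j.+1)).

Let tailS l : tail l = (1 - q ^+ (2 * k * l.+1)) * tail l.+1.
Proof.
rewrite /tail; have [lt_lM | le_Ml] := ltnP l M; first by rewrite big_ltn.
rewrite !big_geq ?(leqW le_Ml) // mulr1 expq_eq0 ?subr0 //.
by move: le_Ml; rewrite /M; nia.
Qed.

Let tail1 l : (N <= l)%N -> tail l = 1.
Proof.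
move=> le_Nl; rewrite /tail big_nat_cond big1 // => j j_bounds.
by rewrite expq_eq0 ?subr0 //; nia.
Qed.

Let c t := (2 * k * t + (2 * k - i))%N.
Let d t l := (c t * l + k * (l * l.-1))%N.

(* With Q = q^(2k) and z = q^(c t), this is (Q;Q)_oo times Euler's expansion  *)
(* sum_l (-z)^l Q^(l(l-1)/2) / (Q;Q)_l of (z;Q)_oo.                           *)
Let euler t := \sum_(l < L) (-1) ^+ l * q ^+ d t l * tail l.

(** This is the functional equation F(z) = (1 - z) F(zQ) of (z;Q)_oo, at z = q^(c t). *)
Let eulerS t : euler t = (1 - q ^+ c t) * euler t.+1.
Proof.
pose u l := (-1) ^+ l * q ^+ d t l * ((1 - q ^+ (2 * k * l)) * tail l).
have dS l : d t.+1 l = (d t l + 2 * k * l)%N by rewrite /d /c; nia.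
suff sum_u : - (q ^+ c t * euler t.+1) = \sum_(l < L) u l.
  rewrite mulrBl mul1r sum_u -big_split; apply: eq_bigr => l _ /=.
  by rewrite /u dS exprD; ring.
rewrite (@shift_sum _ u); last 2 first.
- by rewrite /u !muln0 subrr mul0r mulr0.
- by rewrite /u expq_eq0 ?mulr0 ?mul0r // /d /c /L; nia.
rewrite mulr_sumr -sumrN; apply: eq_bigr => l _; rewrite /u -tailS.
have -> : d t l.+1 = (c t + d t.+1 l)%N.
  by rewrite /d /c; case: (nat_of_ord l) => [|m] /=; nia.
by rewrite exprD exprS; ring.
Qed.

Let euler_prod : euler 0 = \prod_(t < M) (1 - q ^+ c t) * tail 0.
Proof.
have ->: tail 0 = euler M.
  rewrite /euler /L addnS big_ord_recl big1 => [|l _]; last first.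
    by rewrite expq_eq0 ?mulr0 ?mul0r //= /d /c /bump /M; nia.
  by rewrite /d !muln0 !mul1r addr0.
elim: (M) => [|m IHm]; first by rewrite big_ord0 mul1r.
by rewrite IHm eulerS big_ord_recr /= mulrA.
Qed.

(** The value of k x^2 + (k-i) x at the integer x = l - s, split by the sign of x; it is never
    negative, so no subtraction truncates. *)
Let e l s := (if s <= l then k * (l - s) ^ 2 + (k - i) * (l - s)
              else k * (s - l) ^ 2 - (k - i) * (s - l))%N.
(* Up to the factor (Q;Q)_oo, this expands (z;Q)_oo times the first s factors *)
(* of (Q/z;Q)_oo, where Q = q^(2k) and z = q^(2k-i).                          *)
Let theta s := \sum_(l < L) (-1) ^+ (l + s) * q ^+ e l s * tail l.

Let theta0 : theta 0 = euler 0.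
Proof.
apply: eq_bigr => l _; rewrite addn0; congr (_ * q ^+ _ * _).
by rewrite /e /d /c subn0; case: (nat_of_ord l) => [|m] /=; nia.
Qed.

Let e_shift l s : (e l s + (2 * k * s + i) = e l s.+1 + 2 * k * l)%N.
Proof.
rewrite /e; case: (ltngtP s l) => [lt_sl | lt_ls | ->].
- have [r ->] : exists r, l = (s.+1 + r)%N; [by exists (l - s.+1)%N; lia|].
  by rewrite (_ : s.+1 + r - s = r.+1)%N ?addKn; nia.
- have [r ->] : exists r, s = (l + r.+1)%N; [by exists (s - l.+1)%N; lia|].
  rewrite -addnS !addKn; have: ((k - i) * r.+2 <= k * r.+2 ^ 2)%N by nia.
  have: ((k - i) * r.+1 <= k * r.+1 ^ 2)%N by nia.
  nia.
- by rewrite subnn subSn ?subnn; nia.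
Qed.

Let thetaS s : (s < M)%N -> theta s.+1 = (1 - q ^+ (2 * k * s + i)) * theta s.
Proof.
move=> lt_sM; rewrite mulrBl mul1r mulr_sumr.
pose u l := (-1) ^+ (l + s.+1) * q ^+ e l s.+1
  * ((1 - q ^+ (2 * k * l)) * tail l).
(* Since [e l.+1 s.+1] equals [e l s], this is a shift of l combined with [tailS]. Subtracting it
   termwise from [theta s.+1] leaves the terms that [e_shift] evaluates. *)
have ->: theta s = \sum_(l < L) u l.
  rewrite (@shift_sum _ u); last 2 first.
  - by rewrite /u !muln0 subrr mul0r mulr0.
  - rewrite /u expq_eq0 ?mulr0 ?mul0r // /e /L ifT; last by lia.
    by have: (N < M + N.+1 - s.+1)%N by [lia]; move: (_ - _)%N => m; nia.
  apply: eq_bigr => l _; rewrite /u -tailS addSn addnS !exprS !mulN1r opprK.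
  by rewrite /e subSS ltnS.
rewrite -sumrN -big_split; apply: eq_bigr => l _ /=; rewrite /u addnS exprS.
have: q ^+ (2 * k * s + i) * q ^+ e l s = q ^+ e l s.+1 * q ^+ (2 * k * l).
  by rewrite -!exprD -e_shift addnC.
set x := q ^+ (_ + _); set y := q ^+ _; set z := q ^+ _; set w := q ^+ _ => xy.
transitivity (- (-1) ^+ (l + s) * (z - z * w) * tail l
    - (-1) ^+ (l + s) * (x * y) * tail l); last by ring.
rewrite xy; ring.
Qed.

Lemma triple_product :
  \sum_(n < N.+1) (-1) ^+ n *
    (q ^+ (k * n ^ 2 + (k - i) * n) * (1 - q ^+ (i * n.*2.+1))) =
  \prod_(t < M) ((1 - q ^+ (2 * k * t + i))
    * (1 - q ^+ (2 * k * t + (2 * k - i))) * (1 - q ^+ (2 * k * t.+1))).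
Proof.
transitivity (theta M); last first.
  rewrite 2!big_split /= -mulrA.
  rewrite -[X in _ * (_ * X)](big_mkord xpredT
    (fun t => 1 - q ^+ (2 * k * t.+1))).
  rewrite -euler_prod -theta0.
  suff /(_ _ (leqnn M)) -> : forall m, (m <= M)%N ->
    theta m = \prod_(t < m) (1 - q ^+ (2 * k * t + i)) * theta 0 by [].
  elim=> [|m IHm] le_mM; first by rewrite big_ord0 mul1r.
  by rewrite big_ord_recr /= mulrAC -IHm 1?ltnW // mulrC thetaS.
pose v l := (-1) ^+ (l + M) * q ^+ e l M * tail l.
(* The bilateral sum is folded at its centre: x = n and x = -(n+1) together give the n-th term of
   the series, and terms with n > N vanish. *)
have -> : theta M = \sum_(n < N.+1) (v (M + n)%N + v (M - n.+1)%N).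
  rewrite /theta /L big_split_ord /= addrC big_split; congr (_ + _).
  rewrite (reindex_inj rev_ord_inj) /= -/v.
  rewrite -(big_mkord xpredT (fun n => v (M - n.+1)%N)).
  rewrite (big_cat_nat (leq0n N.+1)) /=; last by rewrite /M; lia.
  rewrite big_mkord [X in _ + X]big_nat_cond [X in _ + X]big1 ?addr0 //.
  move=> n n_bounds.
  rewrite /v /e ifF; last by rewrite /M; lia.
  rewrite subKn; last by move: n_bounds; rewrite /M; lia.
  by rewrite expq_eq0 ?mulr0 ?mul0r //; move: n_bounds; nia.
apply: eq_bigr => n _; have := ltn_ord n; rewrite ltnS => le_nN.
rewrite /v !tail1 ?mulr1; last 2 first.
- by rewrite /M; lia.
- by rewrite /M; lia.
rewrite /e leq_addr addKn ifF; last by rewrite /M; lia.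
rewrite subKn; last by rewrite /M; lia.
have sgn m b : odd m = b -> (-1) ^+ m = (-1) ^+ b :> R.
  by move=> <-; rewrite signr_odd.
rewrite (sgn (M + n + M)%N (odd n)) ?(sgn (M - n.+1 + M)%N (~~ odd n));
  last 2 first.
- by rewrite /M; lia.
- by rewrite /M; lia.
rewrite (sgn n (odd n)) // signrN mulNr -mulrBr.
rewrite [X in _ * X = _]mulrBr mulr1 -exprD.
by congr (_ * (_ - q ^+ _)); nia.
Qed.

End TripleProduct.

(** * The series at a = 0 as an infinite product *)

Lemma prod_nat_blocks c m (F : nat -> R) :
  \prod_(1 <= v < (c * m).+1) F v =
  \prod_(t < m) \prod_(r < c) F (c * t + r.+1)%N.
Proof.
rewrite (big_addn 0 _ 1) subn1 /=; elim: m => [|m IHm].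
  by rewrite muln0 big_geq // big_ord0.
rewrite big_ord_recr -IHm mulnS addnC.
rewrite (big_cat_nat (leq0n (c * m)) (leq_addr _ _)) /=.
congr (_ * _); rewrite -{1}[(c * m)%N]add0n big_addn addKn big_mkord.
by apply: eq_bigr => r _; rewrite addn1 addnC addnS.
Qed.

Lemma prod_nat_extend m (F : nat -> R) :
    (N <= m)%N -> (forall v, (N < v)%N -> F v = 1) ->
  \prod_(1 <= v < N.+1) F v = \prod_(1 <= v < m.+1) F v.
Proof.
move=> le_Nm F1; rewrite [RHS](big_cat_nat _ (n := N.+1)) //=.
rewrite [X in _ * X]big_nat_cond.
by rewrite [X in _ * X]big1 ?mulr1 // => v /andP[/andP[/F1]].
Qed.

Lemma gordon_avoids i : (0 < i < k)%N ->
  gordon i 0 = \prod_(1 <= v < N.+1)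
    ((1 + q ^+ v) * (if avoids_residues k i v then 1 else 1 - q ^+ v)).
Proof.
move=> i_bounds; rewrite gordon_first triple_product; last by lia.
rewrite [RHS]big_split /=; congr (_ * _).
rewrite (@prod_nat_extend (2 * k * N.*2.+1)%N); last 2 first.
- by nia.
- by move=> v /expq_eq0 ->; rewrite subr0 if_same.
rewrite prod_nat_blocks; apply: eq_bigr => t _.
have avoidsE r : (0 < r <= 2 * k)%N ->
    avoids_residues k i (2 * k * t + r) =
    [&& r != i, r != 2 * k - i & r != 2 * k]%N.
  move=> r_bounds; rewrite /avoids_residues -addnA mulnC !modnMDl mod0n.
  rewrite (@modn_small i); last by lia.
  have modE u : (2 * k <= u < 2 * (2 * k))%N -> (u %% (2 * k) = u - 2 * k)%N.
    case/andP=> le_u lt_u; rewrite -{1}(subnK le_u) modnDr modn_small //; lia.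
  have [lt_r | ge_r] := ltnP r (2 * k); last first.
    by rewrite modE; lia.
  rewrite (@modn_small r) //; have [lt_ri | ge_ri] := ltnP (r + i) (2 * k).
    by rewrite modn_small; lia.
  by rewrite modE; lia.
pose F r := 1 - q ^+ (2 * k * t + r.+1).
(* As 0 < i < k, the residues i, 2k-i and 2k are distinct, so each period contains exactly the three
   factors of the triple product. *)
have avoids_split r : (0 <= r < 2 * k)%N ->
  (if avoids_residues k i (2 * k * t + r.+1) then 1 else F r) =
  (if r == i.-1 then F r else 1) * (if r == (2 * k - i).-1 then F r else 1)
    * (if r == (2 * k).-1 then F r else 1).
  move=> lt_r; rewrite avoidsE //.
  rewrite -(_ : (r.+1 == i) = (r == i.-1)); last by lia.
  rewrite -(_ : (r.+1 == 2 * k - i)%N = (r == (2 * k - i).-1)); last by lia.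
  rewrite -(_ : (r.+1 == 2 * k)%N = (r == (2 * k).-1)); last by lia.
  case: (r.+1 =P i) => [->|_] /=;
    last case: (r.+1 =P (2 * k - i)%N) => [->|_] /=.
  - by rewrite !ifF ?mulr1 //; lia.
  - by rewrite ifF ?mulr1 ?mul1r //; lia.
  - by case: eqP; rewrite !mul1r.
rewrite -(big_mkord xpredT (fun r => if avoids_residues k i (2 * k * t + r.+1)
  then 1 else F r)).
rewrite (eq_big_nat _ _ avoids_split) 2!big_split /= -!big_mkcond !big_nat1_eq.
rewrite !ifT /F ?prednK ?mulnS ?[(2 * k + _)%N]addnC //; lia.
Qed.

Lemma gordon_ndvd : (0 < k)%N ->
  gordon k 0 =
  \prod_(1 <= v < N.+1) (if (k %| v)%N then 1 - q ^+ v else 1 + q ^+ v).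
Proof.
move=> k_gt0; rewrite gordon_first triple_product; last by lia.
pose M := N.*2.+1.
rewrite !(@prod_nat_extend (k * (2 * M))%N); try by [rewrite /M; nia
  | move=> v /expq_eq0 ->; rewrite ?subr0 ?addr0 ?if_same].
have blocks (F : nat -> R) : \prod_(1 <= v < (k * (2 * M)).+1) F v =
    \prod_(t < 2 * M) (\prod_(r < k.-1) F (k * t + r.+1)%N * F (k * t.+1)%N).
  rewrite prod_nat_blocks; apply: eq_bigr => t _.
  rewrite -!(big_mkord xpredT (fun r => F (k * t + r.+1)%N)) -{1}(prednK k_gt0).
  by rewrite big_nat_recr //= (prednK k_gt0) mulnS addnC.
rewrite 2!{}blocks !big_split /= -!mulrA.
have -> : \prod_(t < 2 * M) \prod_(r < k.-1)
    (if (k %| k * t + r.+1)%N then 1 - q ^+ (k * t + r.+1)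
     else 1 + q ^+ (k * t + r.+1))
  = \prod_(t < 2 * M) \prod_(r < k.-1) (1 + q ^+ (k * t + r.+1)) :> R.
  apply: eq_bigr => t _; apply: eq_bigr => r _; rewrite ifF //.
  by rewrite dvdn_addr ?dvdn_mulr // gtnNdvd // -ltn_predRL.
congr (_ * _); under [RHS]eq_bigr do rewrite dvdn_mulr //.
have odd_even (F : nat -> R) :
    \prod_(t < 2 * M) F t = \prod_(t < M) F t.*2 * \prod_(t < M) F t.*2.+1.
  rewrite mul2n; elim: (M) => [|m IHm]; first by rewrite !big_ord0 mulr1.
  by rewrite doubleS !big_ord_recr /= IHm; ring.
set plus := \prod_(t < 2 * M) (1 + q ^+ (k * t.+1)).
set odds := \prod_(t < M) (1 - q ^+ (2 * k * t + k)).
rewrite (_ : (2 * k - k = k)%N) -/odds; last by lia.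
set evens := \prod_(t < M) (1 - q ^+ (2 * k * t.+1)).
have minusE : \prod_(t < 2 * M) (1 - q ^+ (k * t.+1)) = odds * evens.
  rewrite (odd_even (fun t => 1 - q ^+ (k * t.+1))).
  by congr (_ * _); apply: eq_bigr => t _; congr (1 - q ^+ _); nia.
rewrite minusE.
(* Euler: (-y;y)_oo (y;y^2)_oo = 1 for y = q^k. *)
suff euler1 : plus * odds = 1 by rewrite !mulrA euler1 mul1r.
(* Multiply by the cancellable [evens]: [plus] times [odds * evens] is the product of 1 - y^(2(t+1))
   over t < 2M, whose factors with t >= M are 1. *)
apply: (@prod_onemq_reg [seq 2 * k * (val t).+1 | t <- index_enum 'I_M]%N).
  by apply/allP=> _ /mapP[t _ ->]; nia.
rewrite big_map -/evens mulr1 mulrCA [evens * _]mulrC -minusE -big_split /=.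
rewrite -(big_mkord xpredT
  (fun t => (1 + q ^+ (k * t.+1)) * (1 - q ^+ (k * t.+1)))).
rewrite (big_cat_nat (leq0n M)) /=; last by lia.
rewrite [X in _ * X]big_nat_cond [X in _ * X]big1 => [|t]; last first.
  case/andP=> /andP[le_Mt _] _; rewrite expq_eq0 ?subr0 ?addr0 ?mulr1 //.
  by move: le_Mt; rewrite /M; nia.
rewrite mulr1 big_mkord; apply: eq_bigr => t _.
by rewrite -mulnA mul2n -addnn exprD; ring.
Qed.

End Gordon.
End Truncated.

(** * Enumeration of overpartitions *)

Definition block (v : nat) (b : bool) (m : nat) : seq part :=
  nseq b (v, true) ++ nseq m (v, false).

Definition weight (s : seq part) : nat := sumn (map value s).

Definition blocks N v :=
  [seq block v b m | b <- [:: false; true], m <- iota 0 N.+1].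

(* vs is meant to be increasing: the block of its head v is appended because  *)
(* the smallest value is listed last in an overpartition.                     *)
Fixpoint overpartitions_over N (vs : seq nat) : seq (seq part) :=
  if vs is v :: vs' then
    [seq t ++ u | u <- blocks N v, t <- overpartitions_over N vs']
  else [:: [::]].

Lemma size_block v b m : size (block v b m) = b + m.
Proof. by rewrite size_cat !size_nseq. Qed.

Lemma count_block a v b m :
  count a (block v b m) = a (v, true) * b + a (v, false) * m.
Proof. by rewrite count_cat !count_nseq. Qed.

Lemma all_block a v b m :
  all a (block v b m) = (b ==> a (v, true)) && ((m == 0) || a (v, false)).
Proof. by rewrite all_cat !all_nseq; case: b. Qed.

Lemma weight_block v b m : weight (block v b m) = v * (b + m).
Proof. by rewrite /weight map_cat !map_nseq sumn_cat !sumn_nseq mulnDr. Qed.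

Lemma weight_cat s t : weight (s ++ t) = weight s + weight t.
Proof. by rewrite /weight map_cat sumn_cat. Qed.

Lemma mem_over_cons N v vs s : reflect
  (exists t b m,
    [/\ t \in overpartitions_over N vs, m <= N & s = t ++ block v b m])
  (s \in overpartitions_over N (v :: vs)).
Proof.
apply: (iffP allpairsP) => /= [[[u t] /= [u_in t_in ->]] |].
  have /allpairsP[[b m] [_ m_in ->]] := u_in.
  by exists t, b, m; split=> //; rewrite mem_iota in m_in.
case=> t [b] [m] [t_in le_mN ->]; exists (block v b m, t); split=> //.
by apply/allpairsP; exists (b, m); rewrite mem_iota !inE; case: b.
Qed.

Lemma mem_over_gt N a vs s :
  path ltn a vs -> s \in overpartitions_over N vs ->
  all (fun d => a < value d) s.
Proof.
elim: vs a s => [|v vs IHvs] a s /=; first by rewrite inE => _ /eqP->.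
case/andP=> lt_av vs_path /mem_over_cons[t [b] [m] [t_in _ ->]].
have t_gt := IHvs _ _ vs_path t_in.
rewrite all_cat all_block /value /= lt_av orbT implybT !andbT.
by apply: sub_all t_gt => d; apply: ltn_trans.
Qed.

Lemma sorted_cat_block t v b m :
  sorted may_follow t -> all (fun d => v < value d) t ->
  sorted may_follow (t ++ block v b m).
Proof.
have block_path d : v < value d -> path may_follow d (block v b m).
  have nonover e : v <= value e -> path may_follow e (nseq m (v, false)).
    elim: m e => //= m IHm e le_ve; by rewrite IHm // /may_follow /= !andbT.
  move=> lt_vd; rewrite /block; case: b => /=; last exact/nonover/ltnW.
  by rewrite nonover // /may_follow /= /value /= lt_vd ltnW.
case: t => [_ _ | d t /= t_sorted /andP[lt_vd t_gt]].
  by apply: (@path_sorted _ _ (v.+1, false)); apply: block_path => /=.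
rewrite cat_path t_sorted block_path //.
by have := mem_last d t; rewrite inE => /predU1P[-> | /(allP t_gt)].
Qed.

Lemma mem_over_sorted N a vs s :
  path ltn a vs -> s \in overpartitions_over N vs -> sorted may_follow s.
Proof.
elim: vs a s => [|v vs IHvs] a s /=; first by rewrite inE => _ /eqP->.
case/andP=> _ vs_path /mem_over_cons[t [b] [m] [t_in _ ->]].
exact: sorted_cat_block (IHvs _ _ vs_path t_in) (mem_over_gt vs_path t_in).
Qed.

(** Once a part of value v occurs, only v can follow, and never overlined; so the copies of v form a
    final block. *)
Lemma split_smallest v s :
    sorted may_follow s -> all (fun d => v <= value d) s ->
  exists t b m, [/\ sorted may_follow t, all (fun d => v < value d) t
                  & s = t ++ block v b m].
Proof.
elim: s => [|d s IHs] s_sorted /=; first by exists [::], false, 0.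
case/andP=> le_vd /(IHs (path_sorted s_sorted)).
case=> t [b] [m] [t_sorted t_gt def_s].
have [lt_vd | le_dv] := ltnP v (value d).
  exists (d :: t), b, m; rewrite /= lt_vd t_gt def_s; split=> //.
  by move: s_sorted; rewrite def_s /= cat_path => /andP[].
have d_v : value d = v by apply/eqP; rewrite eqn_leq le_vd le_dv.
move: s_sorted; rewrite {}def_s /= cat_path.
case: t t_gt {t_sorted} => [_ | e t].
  case: b => [|_].
    by rewrite /= /may_follow /= d_v ltnn andbF.
  case: d d_v {le_vd le_dv} => w [] /= <-; first by exists [::], true, m.
  by exists [::], false, m.+1.
case/andP=> lt_ve _ /= /andP[/andP[/andP[le_ed _] _] _].
by have := leq_trans lt_ve le_ed; rewrite d_v ltnn.
Qed.

Lemma mem_over_iota N a c s :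
    sorted may_follow s -> all (fun d => a < value d <= a + c) s ->
    (forall v, count_mem (v, false) s <= N) ->
  s \in overpartitions_over N (iota a.+1 c).
Proof.
elim: c a s => [|c IHc] a s s_sorted s_bounds s_count.
  case: s s_bounds {s_sorted s_count} => //= d s /andP[/andP[]].
  by rewrite addn0 ltnNge => /negP.
have s_gt : all (fun d => a.+1 <= value d) s.
  by apply: sub_all s_bounds => d /andP[].
have [t [b] [m] [t_sorted t_gt def_s]] := split_smallest s_sorted s_gt.
have t_count v : count_mem (v, false) t <= N.
  by apply: leq_trans (s_count v); rewrite def_s count_cat leq_addr.
apply/mem_over_cons; exists t, b, m; split=> //.
  apply: IHc => //; move: s_bounds; rewrite def_s all_cat => /andP[t_bounds _].
  apply/allP=> d d_in; have /andP[_] := allP t_bounds d d_in.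
  by rewrite addSnnS (allP t_gt d d_in).
apply: leq_trans (s_count a.+1).
rewrite def_s count_cat count_block /= !xpair_eqE !eqxx /= mul1n.
by rewrite addnA leq_addl.
Qed.

(** A list determines its parts above v, hence its final block, whose counts determine [b] and
    [m]. *)
Lemma overpartitions_over_uniq N a vs :
  path ltn a vs -> uniq (overpartitions_over N vs).
Proof.
elim: vs a => [|v vs IHvs] a // /andP[_ vs_path].
apply: (@allpairs_uniq _ _ _ (fun u t => t ++ u)); [|exact: IHvs vs_path|].
  apply: (@allpairs_uniq _ _ _ (block v)); rewrite ?iota_uniq //.
  move=> -[b m] [b' m'] _ _ /= eq_bm.
  have := congr1 (count_mem (v, true)) eq_bm.
  have := congr1 (count_mem (v, false)) eq_bm.
  rewrite !count_block /= !xpair_eqE eqxx /=.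
  rewrite !(mul0n, mul1n, addn0, add0n) => ->.
  by case: (b) (b') => [] [].
case=> [u t] [u' t'] /allpairsP[[u0 t0] [u_in t_in [-> ->]]].
move=> /allpairsP[[u1 t1] [u'_in t'_in [-> ->]]].
rewrite [in X in X -> _]/= => eq_tu.
have eq_t : t0 = t1.
  have := congr1 (filter (fun d => v < value d)) eq_tu.
  have filter_gt w w' : w \in overpartitions_over N vs -> w' \in blocks N v ->
      [seq d <- w ++ w' | v < value d] = w.
    move=> /(mem_over_gt vs_path) /all_filterP w_gt /allpairsP[[b m] [_ _ ->]].
    rewrite filter_cat w_gt (_ : filter _ _ = [::]) ?cats0 //.
    by apply/eqP; rewrite -size_eq0 size_filter count_block /value /= ltnn.
  by rewrite !filter_gt.
by move: eq_tu; rewrite eq_t => /eqP; rewrite eqseq_cat // eqxx => /eqP ->.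
Qed.

Lemma overpartition_mem n s :
  is_overpartition n s =
  (s \in overpartitions_over n (iota 1 n)) && (weight s == n).
Proof.
apply/and3P/andP => [[s_sorted s_gt0 /eqP weight_s] | [s_in weight_s]].
  have le_weight v f : v > 0 -> count_mem (v, f) s <= weight s.
    move=> v_gt0; rewrite /weight; elim: (s) => //= d t IHt; apply: leq_add IHt.
    by case: eqP => // ->.
  split; last exact/eqP.
  apply: mem_over_iota => // [|v].
    apply/allP=> d d_in; rewrite (allP s_gt0 d d_in) -weight_s /weight add0n.
    elim: (s) d_in => //= e t IHt; rewrite inE => /predU1P[-> | /IHt le_d].
      exact: leq_addr.
    exact: leq_trans le_d (leq_addl _ _).
  case: v => [|v]; last by rewrite -weight_s le_weight.
  rewrite (@eq_in_count _ _ pred0) ?count_pred0 // => d /(allP s_gt0).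
  by case: d => [[|v] f].
have vs_path : path ltn 0 (iota 1 n) by apply: (iota_ltn_sorted 0 n.+1).
split=> //; first exact: mem_over_sorted vs_path s_in.
exact: mem_over_gt vs_path s_in.
Qed.

Lemma card_overpartitions n (P : pred (seq part)) :
  #|[set s : overpartition n | P (parts s)]| =
  count_mem n [seq weight s | s <- overpartitions_over n (iota 1 n) & P s].
Proof.
rewrite count_map count_filter -size_filter cardsE cardE /enum_mem -enumT.
rewrite -(size_map (@parts n)) -filter_map; apply/perm_size/uniq_perm.
- by rewrite filter_uniq // map_inj_uniq ?enum_uniq //; apply: val_inj.
- by rewrite filter_uniq //; apply: (@overpartitions_over_uniq n 0);
    apply: (iota_ltn_sorted 0 n.+1).
move=> s; rewrite !mem_filter /=.
have -> : (s \in [seq parts i | i <- enum {: overpartition n}]) =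
    is_overpartition n s.
  apply/mapP/idP => [[x _ ->] | s_op]; first exact: (valP x).
  by exists (Overpartition s_op); rewrite ?mem_enum.
rewrite overpartition_mem.
by case: (P s); case: (weight s == n); case: (s \in _).
Qed.

(** * Generating functions of overpartitions *)

Definition gf (R : comNzRingType) (q : R) N (P : pred (seq part)) vs : R :=
  (\sum_(s <- overpartitions_over N vs | P s) q ^+ weight s)%R.

Section GeneratingFunctions.

Local Open Scope ring_scope.

Variables (R : comNzRingType) (q : R) (N : nat).
Hypothesis q_nilp : q ^+ N.+1 = 0.

Local Notation gf := (gf q N).

Lemma gf_cons P v vs : gf P (v :: vs) =
  \sum_(b <- [:: false; true]) \sum_(m < N.+1)
    q ^+ (v * (b + m)) * gf (fun t => P (t ++ block v b m)) vs.
Proof.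
rewrite /gf big_mkcond !big_allpairs_dep.
apply: eq_bigr => b _; rewrite -(big_mkord xpredT (fun m => q ^+ (v * (b + m)) *
  \sum_(t <- overpartitions_over N vs | P (t ++ block v b m)) q ^+ weight t)).
rewrite /index_iota subn0; apply: eq_bigr => m _.
rewrite mulr_sumr [RHS]big_mkcond.
apply: eq_bigr => t _; rewrite weight_cat weight_block addnC exprD.
by case: ifP.
Qed.

Lemma gf_eq (P P' : pred (seq part)) vs :
    {in overpartitions_over N vs, P =1 P'} -> gf P vs = gf P' vs.
Proof.
move=> eq_P; rewrite /gf !(big_mkcond P) !(big_mkcond P') /=.
by apply: eq_big_seq => s /eq_P ->.
Qed.

(** Each value v contributes 1 + q^v if it may be overlined, and a geometric series if it may occur
    non-overlined; cutting the latter at m = N is exact as q^(v(N+1)) = 0. *)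
Lemma gf_all (p : pred part) vs : all (fun v => 0 < v)%N vs ->
  gf (all p) vs * \prod_(v <- vs) (1 - q ^+ v) =
  \prod_(v <- vs) ((if p (v, true) then 1 + q ^+ v else 1)
                   * (if p (v, false) then 1 else 1 - q ^+ v)).
Proof.
elim: vs => [|v vs IHvs] /=.
  by rewrite /gf big_cons !big_nil addr0 mulr1 expr0.
case/andP=> v_gt0 /IHvs{IHvs} IHvs; rewrite !big_cons mulrCA -{}IHvs !mulrA.
congr (_ * _).
pose ind (c : bool) : R := if c then 1 else 0.
pose geom := \sum_(m < N.+1)
  ind ((m == 0 :> nat) || p (v, false)) * q ^+ (v * m).
have gf_geom : gf (all p) (v :: vs) =
    (if p (v, true) then 1 + q ^+ v else 1) * geom * gf (all p) vs.
  have row (b : bool) : \sum_(m < N.+1)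
      q ^+ (v * (b + m)) * gf (fun t => all p (t ++ block v b m)) vs =
      ind (b ==> p (v, true)) * q ^+ (v * b) * geom * gf (all p) vs.
    rewrite -!mulrA mulr_suml !mulr_sumr; apply: eq_bigr => m _.
    have -> : gf (fun t => all p (t ++ block v b m)) vs =
        ind (b ==> p (v, true)) * ind ((m == 0 :> nat) || p (v, false))
          * gf (all p) vs.
      have all_cat_block t : all p (t ++ block v b m) = all p t &&
          ((b ==> p (v, true)) && ((m == 0 :> nat) || p (v, false))).
        by rewrite all_cat all_block.
      rewrite /ind; case: ifP all_cat_block => _; last first.
        rewrite !mul0r => pt; rewrite /gf big_pred0 // => t.
        by rewrite pt !andbF.
      case: ifP => _ pt; last first.
        by rewrite mulr0 !mul0r /gf big_pred0 // => t; rewrite pt !andbF.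
      by rewrite !mul1r; apply: gf_eq => t _; rewrite pt !andbT.
    by rewrite mulnDr exprD; ring.
  rewrite gf_cons big_cons big_seq1 !row /ind /= muln0 muln1.
  by case: ifP => _; ring.
suff <- : (1 - q ^+ v) * geom = if p (v, false) then 1 else 1 - q ^+ v.
  by rewrite gf_geom; move: (if _ then _ else _) (gf _ _) => x y; ring.
rewrite /geom /ind; case: (p (v, false)).
  under eq_bigr do rewrite orbT mul1r exprM.
  rewrite -opprB mulNr -subrX1 -exprM (expq_eq0 q_nilp) ?sub0r ?opprK //.
  exact: leq_pmull.
rewrite big_ord_recl big1 => [|m _]; first by rewrite muln0 addr0 mul1r mulr1.
by rewrite mul0r.
Qed.

End GeneratingFunctions.

(** * The difference condition *)

(** A window of k parts that ends in the block of v is fine if it starts above v+1 or at an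
    overlined v+1, and fails if it starts at a non-overlined v+1 or at v. The parts of the latter
    two kinds are the last c+b+m ones, so failure is avoided exactly when there are fewer than k of
    them. *)
Lemma difference_condition_block k v b b' c m t : 0 < k ->
    all (fun d => v.+1 < value d) t ->
  difference_condition k ((t ++ block v.+1 b' c) ++ block v b m) =
  difference_condition k (t ++ block v.+1 b' c) && (c + (b + m) < k).
Proof.
move=> k_gt0 t_gt.
pose p0 : part := (0, false).
have diffP s : reflect
    (forall j, j + k <= size s -> let d := nth p0 s j in
     (if overlined d then 1 else 2) <= value d - value (nth p0 s (j + k - 1)))
    (difference_condition k s).
  apply: (iffP forallP) => [cond_s j le_jk | cond_s j].
    by have lt_j : j < size s; [lia | exact: (implyP (cond_s (Ordinal lt_j)))].
  exact/implyP/cond_s.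
set s := t ++ _; set u := block v b m.
have size_u : size u = b + m := size_block v b m.
have le_c : c <= size s by rewrite size_cat size_block; lia.
have nth_u j : size s <= j < size s + (b + m) -> value (nth p0 (s ++ u) j) = v.
  case/andP=> le_j lt_j; rewrite nth_cat ltnNge le_j /=.
  have : nth p0 u (j - size s) \in u by rewrite mem_nth // size_u; lia.
  by rewrite mem_cat => /orP[] /nseqP[->].
have nth_s j : size s - c <= j < size s -> nth p0 (s ++ u) j = (v.+1, false).
  move=> j_bounds; rewrite nth_cat ifT; last by lia.
  move: j_bounds; rewrite /s /block catA size_cat size_nseq addnK nth_cat.
  by case/andP=> le_j lt_j; rewrite ltnNge le_j /= nth_nseq ifT //; lia.
have nth_gt j : j < size s - c -> let d := nth p0 s j in
    (if overlined d then 1 else 2) <= value d - v.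
  rewrite /s /block catA size_cat size_nseq addnK nth_cat => lt_j.
  have := mem_nth p0 lt_j; rewrite lt_j /=; set d := nth _ _ _.
  rewrite mem_cat => /orP[/(allP t_gt) | /nseqP[-> _]]; last first.
    by rewrite /value /=; lia.
  by case: (overlined d); move: (value d) => w /=; lia.
clearbody s u; apply/diffP/andP => [cond_su | [/diffP cond_s lt_k] j le_jk].
  split.
    apply/diffP=> j le_jk; have := cond_su j.
    by rewrite size_cat !nth_cat !ifT; lia.
  rewrite ltnNge; apply/negP=> le_k.
  (* A violating window: the first k copies of v if there are that many, otherwise the last k parts
     of the list. *)
  have [le_kbm | lt_bmk] := leqP k (b + m).
    have := cond_su (size s); rewrite size_cat size_u /= !nth_u; try lia.
    by case: ifP; lia.
  have := cond_su (size s + (b + m) - k).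
  rewrite size_cat size_u /= subnK; last by lia.
  move/(_ (leqnn _)); rewrite nth_s /=; last by lia.
  have [bm0 | bm_gt0] := posnP (b + m); last by rewrite nth_u /value /=; lia.
  by rewrite nth_s /value /=; lia.
have [le_js | lt_sj] := leqP (j + k) (size s).
  have := cond_s j le_js; rewrite !nth_cat !ifT //; lia.
rewrite size_cat size_u in le_jk.
rewrite nth_u; last by lia.
by rewrite nth_cat ifT; [apply: nth_gt|]; lia.
Qed.

Section Differences.

Local Open Scope ring_scope.

Variables (R : comNzRingType) (q : R) (N k : nat).
Hypotheses (q_nilp : q ^+ N.+1 = 0) (k_gt0 : (0 < k)%N).

(** This is D_i(a); the strict bound makes it 0 at i = 0. *)
Definition gordon_gf i a := gf q N
  (fun s => (count_mem (a.+1, false) s < i)%N && difference_condition k s)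
  (iota a.+1 (N - a)).

Lemma count_over_cons v b m vs t :
    path ltn v vs -> t \in overpartitions_over N vs ->
  count_mem (v, false) (t ++ block v b m) = m.
Proof.
move=> vs_path /(mem_over_gt vs_path) t_gt; rewrite count_cat count_block /=.
rewrite !xpair_eqE eqxx /= mul0n mul1n.
rewrite (@eq_in_count _ _ pred0) ?count_pred0 // => d.
by move/(allP t_gt) => /=; apply: contraTF => /eqP ->; rewrite ltnn.
Qed.

Lemma iota_path a c : path ltn a (iota a.+1 c).
Proof. exact: (iota_ltn_sorted a c.+1). Qed.

Lemma difference_condition_over v b m c t :
    t \in overpartitions_over N (iota v.+1 c) ->
  difference_condition k (t ++ block v b m) =
  (count_mem (v.+1, false) t < k - (b + m))%N && difference_condition k t.
Proof.
case: c => [|c].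
  rewrite inE => /eqP ->; rewrite -[[::]]/([::] ++ block v.+1 false 0).
  by rewrite difference_condition_block //= andbC subn_gt0.
case/mem_over_cons=> t' [b'] [m'] [t'_in _ ->].
rewrite (count_over_cons _ _ (iota_path _ _) t'_in).
rewrite difference_condition_block //.
  by rewrite andbC ltn_subRL addnC.
exact: mem_over_gt (iota_path _ _) t'_in.
Qed.

Lemma gordon_gf_last i : gordon_gf i N = (0 < i)%:R.
Proof.
rewrite /gordon_gf subnn /gf big_cons big_nil /=.
have -> : difference_condition k [::] by apply/forallP=> -[].
by rewrite andbT; case: ifP; rewrite ?addr0 // expr0.
Qed.

Lemma gordon_gf_sum i a : (a < N)%N ->
  gordon_gf i a = \sum_(m < i) (q ^+ (a.+1 * m) * gordon_gf (k - m) a.+1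
    + q ^+ (a.+1 * m.+1) * gordon_gf (k - m.+1) a.+1).
Proof.
move=> lt_aN; pose F m := q ^+ (a.+1 * m) * gordon_gf (k - m) a.+1
  + q ^+ (a.+1 * m.+1) * gordon_gf (k - m.+1) a.+1.
have -> : gordon_gf i a = \sum_(m < N.+1 | (m < i)%N) F m.
  rewrite /gordon_gf -(subnSK lt_aN) /= gf_cons big_cons big_seq1 -big_split /=.
  rewrite [RHS]big_mkcond; apply: eq_bigr => m _.
  have row (b : bool) : gf q N
        (fun t => (count_mem (a.+1, false) (t ++ block a.+1 b m) < i)%N
          && difference_condition k (t ++ block a.+1 b m))
        (iota a.+2 (N - a.+1)) =
      if (m < i)%N then gordon_gf (k - (b + m)) a.+1 else 0.
    case: ifPn => [lt_mi | ge_mi].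
      apply: gf_eq => t t_in /=.
      rewrite (count_over_cons _ _ (iota_path _ _) t_in) lt_mi.
      exact: difference_condition_over t_in.
    rewrite /gf big1_seq // => t /andP[/andP[+ _] t_in].
    by rewrite (count_over_cons _ _ (iota_path _ _) t_in) (negPf ge_mi).
  by rewrite !row; case: ifP => // _; rewrite !mulr0 addr0.
(* The enumeration stops at multiplicity N; terms with m > N carry a vanishing power of q. *)
have [le_iN | lt_Ni] := leqP i N.+1; first by rewrite -big_ord_widen.
rewrite [RHS](bigID (fun m : 'I_i => m < N.+1)%N) /= [X in _ + X]big1 ?addr0.
  rewrite -(big_ord_widen _ F (ltnW lt_Ni)); apply: eq_bigl => m.
  exact: ltn_trans (ltn_ord m) lt_Ni.
move=> m; rewrite -ltnNge => lt_Nm.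
by rewrite /F !(expq_eq0 q_nilp) ?mul0r ?mul0r ?addr0 //; nia.
Qed.

(** Downward induction on a from N, and for each a induction on i, as both sides obey the same
    recurrence. *)
Lemma gordon_gfE i a : (a <= N)%N -> (i <= k)%N ->
  gordon q N k i a = gordon_gf i a * \prod_(1 <= j < N.+1) (1 - q ^+ j).
Proof.
move=> le_aN; rewrite -(subKn le_aN); move: (N - a)%N (leq_subr a N) => d.
elim: d i => [|d IHd] i le_dN.
  rewrite subn0 gordon_gf_last; case: i => [_ | i le_ik].
    by rewrite gordon0 mul0r.
  by rewrite gordon_last // mul1r.
have lt_aN' : (N - d.+1 < N)%N by lia.
have aS : (N - d.+1).+1 = (N - d)%N by lia.
elim: i => [|i IHi] le_ik.
  by rewrite gordon0 (gordon_gf_sum _ lt_aN') big_ord0 mul0r.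
rewrite gordonS // IHi 1?ltnW // !(gordon_gf_sum _ lt_aN') big_ord_recr /= aS.
rewrite !IHd ?leq_subr 1?ltnW //; ring.
Qed.

End Differences.

(** * Counting through integer polynomials modulo X^(n+1) *)

Section TruncatedIntegers.

Local Open Scope ring_scope.

Variable n : nat.

Local Notation Zn := {poly %/ ('X^(n.+1) : {poly int})}.
Local Notation q := ('qX : Zn).

Lemma qX_nilp : q ^+ n.+1 = 0.
Proof.
rewrite -rmorphXn /=; apply: val_inj => /=.
by rewrite mk_monic_Xn /= Pdiv.RingMonic.rmodpp ?monicXn.
Qed.

Lemma qX_sum_inj (r r' : seq nat) :
    \sum_(e <- r) q ^+ e = \sum_(e <- r') q ^+ e ->
  count_mem n r = count_mem n r'.
Proof.
have coefn s : (\sum_(e <- s) q ^+ e : {poly int})`_n = (count_mem n s)%:R.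
  under eq_bigr do rewrite -rmorphXn.
  rewrite -rmorph_sum /= mk_monic_Xn /=.
  have /(congr1 (fun p : {poly int} => p`_n)) :=
    Pdiv.RingMonic.rdivp_eq (monicXn int n.+1) (\sum_(e <- s) 'X^e).
  rewrite coefD coefMXn ltnSn add0r => <-.
  rewrite coef_sum -sum1_count natr_sum [RHS]big_mkcond; apply: eq_bigr => e _.
  by rewrite coefXn /= eq_sym; case: (e == n).
move=> /(congr1 (fun p : Zn => (p : {poly int})`_n)); rewrite !coefn => /eqP.
by rewrite Num.Theory.eqr_nat => /eqP.
Qed.

Lemma card_gf (P P' : pred (seq part)) :
    gf q n P (iota 1 n) = gf q n P' (iota 1 n) ->
  #|[set s : overpartition n | P (parts s)]| =
  #|[set s : overpartition n | P' (parts s)]|.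
Proof.
rewrite !card_overpartitions => eq_gf; apply: qX_sum_inj.
by rewrite !big_map !big_filter.
Qed.

End TruncatedIntegers.

Theorem theorem1p4 (k i : nat) (hi : 1 <= i) (hik : i <= k) (n : nat) :
  C k i n = D k i n.
Proof.
have k_gt0 := leq_trans hi hik.
pose q : {poly %/ ('X^(n.+1) : {poly int})} := 'qX%R.
have q_nilp : (q ^+ n.+1 = 0)%R := qX_nilp n.
have iotaE : iota 1 n = index_iota 1 n.+1 by rewrite /index_iota subn1.
pose PD (s : seq part) :=
  (count_mem (1, false) s <= i - 1) && difference_condition k s.
have gfD : gf q n PD (iota 1 n) = gordon_gf q n k i 0.
  by rewrite /gordon_gf subn0; apply: gf_eq => s _; congr (_ && _); lia.
(* Both cases of [C] count the overpartitions all of whose parts satisfy some [p], so they differ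
   only in the product to be matched. *)
suff gfC (p : pred part) : (gordon q n k i 0 =
    \prod_(1 <= v < n.+1) ((if p (v, true) then 1 + q ^+ v else 1)
      * (if p (v, false) then 1 else 1 - q ^+ v)))%R ->
  #|[set s : overpartition n | all p (parts s)]| = D k i n.
  rewrite /C; case: ltnP => [lt_ik | le_ki]; apply: gfC.
    by rewrite gordon_avoids ?hi.
  have -> : i = k by apply/eqP; rewrite eqn_leq hik.
  rewrite gordon_ndvd //; apply: eq_bigr => v _ /=; rewrite /value /=.
  by case: ifP; rewrite ?GRing.mul1r ?GRing.mulr1.
move=> gordonE; apply: (@card_gf n (all p) PD); rewrite -/q gfD.
have iota_gt0 : all (leq 1) (iota 1 n).
  by apply/allP=> v; rewrite mem_iota => /andP[].
apply: (prod_onemq_reg q_nilp iota_gt0).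
rewrite [LHS]GRing.mulrC gf_all // iotaE -gordonE gordon_gfE //.
exact: GRing.mulrC.
Qed.
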